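(* Let $d$ be a graphical degree function on a finite set $V$ and let $v\in V$. Then the quotient at $v$ is the Johnson graph $J(I_v)$; that is, for $S,T\in I_v$, $S$ and $T$ are adjacent in the quotient at $v$ if and only if $|S\triangle T|=2$.
   Context: All graphs are finite and simple. A degree function on a finite set $V$ with $|V|=n$ is a map $d:V\to\{0,1,\dots,n-1\}$; it is graphical if some simple graph on $V$ has $\deg(u)=d(u)$ for all $u$; such a labeled graph is a realization of $d$. The realization graph $G(d)$ has as vertices all realizations of $d$, two being adjacent when the symmetric difference of their edge sets has exactly four elements (equivalently, they differ by a single 2-switch). For $S\subseteq V\setminus\{v\}$, the fiber is $\Phi_S=\{G: G\text{ realizes }d,\ N_G(v)=S\}$, and $I_v=\{S:\Phi_S\ne\emptyset\}$. The quotient at $v$ is the graph on vertex set $I_v$ in which distinct $S$ and $T$ are adjacent when some member of $\Phi_S$ is adjacent in $G(d)$ to some member of $\Phi_T$. The Johnson graph $J(F)$ of a family $F$ of sets of equal size has vertex set $F$, with $X,Y$ adjacent iff $|X\triangle Y|=2$. *)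

(* Defs.v *)
From HB Require Import structures.
From mathcomp Require Import all_boot.

Set Implicit Arguments.
Unset Strict Implicit.
Unset Printing Implicit Defensive.

Definition symdiff (T : finType) (A B : {set T}) : {set T} :=
  (A :\: B) :|: (B :\: A).

(* The condition is boolean, so that two graphs are Leibniz-equal as soon as   *)
(* they have the same vertex set and the same edge set.                        *)
Definition sgraph_axiom (T : finType) (g : {set T} * {set {set T}}) : bool :=
  [forall e in g.2, (e \subset g.1) && (#|e| == 2)].

(* Simple graphs whose vertices form a subset of T. *)
Record sgraph (T : finType) := SGraph {
  sgraph_val : {set T} * {set {set T}};
  sgraphP : sgraph_axiom sgraph_val
}.

HB.instance Definition _ (T : finType) := [isSub for @sgraph_val T].
HB.instance Definition _ (T : finType) := [Finite of sgraph T by <:].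

Section Graphs.
Variable T : finType.
Implicit Types (G : sgraph T) (W : {set T}) (r : rel T) (x y : T).

Definition vertices G : {set T} := (sgraph_val G).1.
Definition edges G : {set {set T}} := (sgraph_val G).2.
Definition adj G : rel T := fun x y => [set x; y] \in edges G.
Definition nbhd G x : {set T} := [set y | adj G x y].
Definition deg G x : nat := #|nbhd G x|.

Lemma mksgraph_subproof W r :
  sgraph_axiom (W, [set [set x; y] | x in W, y in W & (x != y) && r x y]).
Proof.
apply/forall_inP => e /imset2P[x y xW]; rewrite inE => /and3P[yW xy _] ->.
by rewrite subUset !sub1set xW yW cards2 xy.
Qed.

(* r is meant to be symmetric; loops are discarded. *)
Definition mksgraph W r : sgraph T := SGraph (mksgraph_subproof W r).

Lemma adj_mksgraph W r x y : symmetric r ->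
  adj (mksgraph W r) x y = [&& x \in W, y \in W, x != y & r x y].
Proof.
move=> rC; apply/imset2P/and4P => [[a b aW] | [xW yW xy rxy]]; last first.
  by exists x y => //; rewrite inE yW xy.
rewrite inE => /and3P[bW ab rab] E.
have xy : x != y by move: (cards2 x y); rewrite E cards2 ab; case: (x != y).
have : x \in [set a; b] by rewrite -E set21.
have : y \in [set a; b] by rewrite -E set22.
rewrite !inE => /orP[] /eqP ya /orP[] /eqP xa; subst.
- by rewrite eqxx in xy.
- by rewrite rC.
- by [].
- by rewrite eqxx in xy.
Qed.

End Graphs.

Section Realizations.
Variables (V : finType) (d : V -> 'I_#|V|).
Implicit Types (G H : sgraph V) (v : V) (S : {set V}).

Definition realizes G : bool :=
  (vertices G == setT) && [forall u, deg G u == d u].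

Definition graphical : Prop := exists G, realizes G.

Definition realizations : {set sgraph V} := [set G | realizes G].

Definition realization_graph : sgraph (sgraph V) :=
  mksgraph realizations
    (fun G H => #|symdiff (edges G) (edges H)| == 4).

Definition fiber v S : {set sgraph V} :=
  [set G in realizations | nbhd G v == S].

Definition fiber_index v : {set {set V}} :=
  [set S : {set V} | (S \subset [set~ v]) && (fiber v S != set0)].

Definition quotient_at v : sgraph {set V} :=
  mksgraph (fiber_index v)
    (fun S S' => [exists G in fiber v S, exists H in fiber v S',
                   adj realization_graph G H]).

(* Hence fiber_index v is a legitimate argument for johnson. *)
Lemma card_fiber_index v S : S \in fiber_index v -> #|S| = d v.
Proof.
rewrite inE => /andP[_ /set0Pn[G]]; rewrite !inE => /andP[/andP[_ dG] /eqP <-].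
by apply/eqP; move/forallP: dG; apply.
Qed.

End Realizations.

(* Intended for families of sets of equal size. *)
Definition johnson (V : finType) (F : {set {set V}}) : sgraph {set V} :=
  mksgraph F (fun X Y => #|symdiff X Y| == 2).

Lemma symdiffC (T : finType) (A B : {set T}) : symdiff A B = symdiff B A.
Proof. exact: setUC. Qed.

Lemma adj_realization_graph (V : finType) (d : V -> 'I_#|V|) G H :
  adj (realization_graph d) G H =
    [&& realizes d G, realizes d H & #|symdiff (edges G) (edges H)| == 4].
Proof.
rewrite adj_mksgraph => [|? ?]; last by rewrite symdiffC.
rewrite !inE; case: eqVneq => //= ->.
by rewrite /symdiff setDv setU0 cards0 !andbF.
Qed.

Lemma adj_quotient_at (V : finType) (d : V -> 'I_#|V|) v S T :
  adj (quotient_at d v) S T =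
    [&& S \in fiber_index d v, T \in fiber_index d v, S != T &
      [exists G in fiber d v S, exists H in fiber d v T,
         adj (realization_graph d) G H]].
Proof.
rewrite adj_mksgraph => [//|{}S {}T].
have half A B : [exists G in fiber d v A, exists H in fiber d v B,
    adj (realization_graph d) G H] ->
  [exists G in fiber d v B, exists H in fiber d v A,
    adj (realization_graph d) G H].
  case/exists_inP => G GA /exists_inP[H HB GH].
  apply/exists_inP; exists H => //; apply/exists_inP; exists G => //.
  by rewrite /adj setUC.
by apply/idP/idP; apply: half.
Qed.

Lemma adj_johnson (V : finType) (F : {set {set V}}) X Y :
  adj (johnson F) X Y = [&& X \in F, Y \in F & #|symdiff X Y| == 2].
Proof.
rewrite adj_mksgraph => [|? ?]; last by rewrite symdiffC.
case: eqVneq => //= ->.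
by rewrite /symdiff setDv setU0 cards0 !andbF.
Qed.

(* Main.v *)
Require Import Defs.
From mathcomp Require Import all_boot.

(** Both directions rest on the fact that two realizations of [d] give every
    vertex [u] equally many private neighbours: their neighbourhoods of [u] have
    the same size, so each set difference has the size of the other
    ([nbhd_setD_sym]).

    Suppose that [G] and [H] differ in four edges and that [v] has different
    neighbourhoods [S] and [T] in them. Then [S] and [T] differ in a positive
    even number of vertices, at most four. If that number were four, all four
    edges would contain [v], and an end [s] of one of them would lose the edge
    to [v] without being compensated by another edge. So the number is two
    ([symdiff_nbhd_of_adj]).

    Conversely, let [S :\: T = [set s]] and [T :\: S = [set t]], and let [G] and
    [H] be realizations in which the neighbourhood of [v] is [S] and [T]. If [G]
    has a vertex [x] that is adjacent to [t] and neither equal nor adjacent to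
    [s], replacing the edges [vs] and [xt] by [vt] and [xs] is a 2-switch that
    leads from the fiber of [S] to that of [T] ([switch_realization]). When
    there is no such [x], every neighbour of [t] other than [s] is a neighbour
    of [s], while [v] is adjacent to [s] but not to [t]; hence [d t < d s]
    ([switch_or_lt]). The same argument in [H], with [s] and [t] exchanged,
    gives a 2-switch or [d s < d t]. The two strict inequalities exclude each
    other, so one of the 2-switches exists. *)

(** * Finite sets *)

Lemma card_symdiff {T : finType} (A B : {set T}) :
  #|symdiff A B| = #|A :\: B| + #|B :\: A|.
Proof.
rewrite /symdiff cardsU; suff -> : (A :\: B) :&: (B :\: A) = set0.
  by rewrite cards0 subn0.
by apply/setP => x; rewrite !inE; case: (x \in A); rewrite ?andbF.
Qed.

Lemma card_setD_sym {T : finType} (A B : {set T}) :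
  #|A| = #|B| -> #|A :\: B| = #|B :\: A|.
Proof. by move=> AB; rewrite !cardsD AB setIC. Qed.

Lemma symdiffKl {T : finType} (A B : {set T}) : symdiff A (symdiff A B) = B.
Proof.
by apply/setP => x; rewrite !inE; case: (x \in A); case: (x \in B).
Qed.

Lemma eq_set2 {T : finType} (x y a b : T) :
  ([set x; y] == [set a; b]) =
    ((x == a) && (y == b)) || ((x == b) && (y == a)).
Proof.
apply/eqP/orP => [E | [] /andP[/eqP-> /eqP->] //]; last by rewrite setUC.
have : x \in [set a; b] by rewrite -E set21.
have : y \in [set a; b] by rewrite -E set22.
have : a \in [set x; y] by rewrite E set21.
have : b \in [set x; y] by rewrite E set22.
rewrite !inE (eq_sym b x) (eq_sym b y) (eq_sym a x) (eq_sym a y).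
by case: (x == a); case: (y == b); case: (x == b); case: (y == a) => //=; auto.
Qed.

(** * Simple graphs *)

Section SimpleGraphs.
Context {V : finType}.
Implicit Types (G H : sgraph V) (x y u : V).

Lemma edge_card2 {G e} : e \in edges G -> #|e| = 2.
Proof. by case: G => g /= /forall_inP gP /gP /andP[_ /eqP]. Qed.

Lemma adj_sym G x y : adj G x y = adj G y x.
Proof. by rewrite /adj setUC. Qed.

Lemma adj_neq {G x y} : adj G x y -> x != y.
Proof. by move/edge_card2; rewrite cards2; case: (x != y). Qed.

Lemma sgraph_ext G H :
  vertices G = vertices H -> adj G =2 adj H -> G = H.
Proof.
move=> VE AE; apply: val_inj => /=.
suff : edges G = edges H.
  by move: VE; rewrite /vertices /edges; case: (sgraph_val G) => a b /= -> ->;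
     case: (sgraph_val H).
have sub (K L : sgraph V) e : adj K =2 adj L -> e \in edges K -> e \in edges L.
  move=> KL eK; have /eqP/cards2P[x [y [_ e_xy]]] := edge_card2 eK.
  by move: eK; rewrite e_xy -/(adj K x y) -/(adj L x y) KL.
by apply/setP => e; apply/idP/idP; [apply: (sub G H) | apply: (sub H G)] => x y.
Qed.

(** * The 2-switch *)

(** The 4-cycle [a b c d] alternates between edges to remove ([ab], [cd]) and
    edges to insert ([bc], [da]). Keeping both kinds in one set makes the
    2-switch a symmetric difference with this set, and makes the four vertices
    interchangeable by rotation. *)
Definition switch_edges (a b c d : V) : {set {set V}} :=
  [set [set a; b]; [set b; c]; [set c; d]; [set d; a]].

Lemma switch_edges_rot (a b c d : V) :
  switch_edges a b c d = switch_edges b c d a.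
Proof. by rewrite /switch_edges -!setUA setUC !setUA. Qed.

Lemma card_switch_edges (a b c d : V) :
  uniq [:: a; b; c; d] -> #|switch_edges a b c d| = 4.
Proof.
rewrite /= !inE !negb_or => /and4P[/and3P[ab ac ad] /andP[bc bd] _ _].
rewrite /switch_edges -!setUA !cardsU1 cards1 !inE !eq_set2 !eqxx.
rewrite ?(eq_sym b a) ?(eq_sym c a) ?(eq_sym d a) ?(eq_sym d b).
by rewrite (negbTE ab) (negbTE ac) (negbTE ad) (negbTE bc) (negbTE bd) /=
  ?andbF.
Qed.

Lemma switch_edges_at (a b c d : V) : uniq [:: a; b; c; d] ->
  [set y | [set a; y] \in switch_edges a b c d] = [set b; d].
Proof.
rewrite /= !inE !negb_or => /and4P[/and3P[ab ac ad] _ _ _].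
apply/setP => y; rewrite !inE !eq_set2 !eqxx.
by rewrite (negbTE ab) (negbTE ac) (negbTE ad) /= !orbF.
Qed.

Lemma switch_edges_off (a b c d u : V) : u \notin [:: a; b; c; d] ->
  [set y | [set u; y] \in switch_edges a b c d] = set0.
Proof.
rewrite !inE !negb_or => /and4P[/negbTE ua /negbTE ub /negbTE uc /negbTE ud].
by apply/setP => y; rewrite !inE !eq_set2 ua ub uc ud.
Qed.

Lemma symdiff_set2 (A : {set V}) (b d : V) :
  b \in A -> d \notin A -> symdiff A [set b; d] = d |: A :\ b.
Proof.
move=> bA dA; apply/setP => y; rewrite !inE.
have [->|_] := eqVneq y d; first by rewrite (negbTE dA) orbT.
by case: eqVneq => [->|_] /=; rewrite ?bA ?andbT ?andbF ?orbF.
Qed.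

Lemma card_swap (A : {set V}) (b d : V) :
  b \in A -> d \notin A -> #|d |: A :\ b| = #|A|.
Proof.
move=> bA dA; rewrite cardsU1 !inE (negbTE dA) andbF add1n.
by rewrite (cardsD1 b A) bA.
Qed.

(** Taking the symmetric difference with a fixed set of pairs acts on every
    neighbourhood separately, so degrees can be compared vertex by vertex. *)
Lemma exists_toggle {G} {F : {set {set V}}} : (forall e, e \in F -> #|e| = 2) ->
  exists G', [/\ vertices G' = setT, edges G' = symdiff (edges G) F &
    forall u, nbhd G' u = symdiff (nbhd G u) [set y | [set u; y] \in F]].
Proof.
move=> F2.
have ax : sgraph_axiom ([set: V], symdiff (edges G) F).
  apply/forall_inP => e; rewrite subsetT inE => /orP[] /setDP[eE _];
    apply/eqP; [exact: (edge_card2 eE) | exact: F2].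
exists (SGraph ax); split=> // u.
by apply/setP => y; rewrite !inE /adj /edges /= !inE.
Qed.

End SimpleGraphs.

Section Realizations.
Context {V : finType} {d : V -> 'I_#|V|}.
Implicit Types (G H : sgraph V) (u v s t x : V) (S T : {set V}).

Lemma realizes_deg G u : realizes d G -> #|nbhd G u| = d u.
Proof. by case/andP => _ /forallP/(_ u)/eqP. Qed.

(** The 2-switch on the 4-cycle [v s x t]. Each of the four vertices is on one
    removed and one inserted edge, hence keeps its degree. *)
Lemma switch_realization {G} {v s x t} : realizes d G ->
  adj G v s -> adj G x t -> ~~ adj G s x -> ~~ adj G t v -> s != x -> v != t ->
  exists G', [/\ realizes d G', adj (realization_graph d) G G' &
    nbhd G' v = t |: nbhd G v :\ s].
Proof.
move=> dG vs xt sx tv s_x v_t.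
have Uv : uniq [:: v; s; x; t].
  rewrite /= !inE !negb_or (adj_neq vs) (adj_neq xt) s_x v_t !andbT /=.
  apply/andP; split; apply/eqP => E; first by move: tv; rewrite adj_sym E xt.
  by move: tv; rewrite -E adj_sym vs.
have rotU (a b c e : V) : uniq [:: a; b; c; e] -> uniq [:: b; c; e; a].
  by rewrite -(rot_uniq 1).
have Us := rotU _ _ _ _ Uv; have Ux := rotU _ _ _ _ Us.
have Ut := rotU _ _ _ _ Ux.
have F2 e : e \in switch_edges v s x t -> #|e| = 2.
  rewrite !inE -!orbA => /or4P[] /eqP->; rewrite cards2.
  - by rewrite (adj_neq vs).
  - by rewrite s_x.
  - by rewrite (adj_neq xt).
  - by rewrite eq_sym v_t.
have [G' [G'T EG' NG']] := @exists_toggle _ G _ F2.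
have Nv : nbhd G' v = t |: nbhd G v :\ s.
  by rewrite NG' switch_edges_at // symdiff_set2 ?inE // adj_sym.
have dG' : realizes d G'.
  rewrite /realizes G'T eqxx; apply/forallP => u; apply/eqP.
  rewrite -(realizes_deg _ u dG) /deg.
  have [|uF] := boolP (u \in [:: v; s; x; t]); last first.
    by rewrite NG' switch_edges_off // /symdiff set0D setD0 setU0.
  rewrite !inE => /or4P[] /eqP->.
  - by rewrite Nv card_swap ?inE // adj_sym.
  - rewrite NG' switch_edges_rot switch_edges_at // setUC.
    by rewrite symdiff_set2 ?card_swap ?inE // adj_sym.
  - rewrite NG' 2!switch_edges_rot switch_edges_at //.
    by rewrite symdiff_set2 ?card_swap ?inE // adj_sym.
  - rewrite NG' 3!switch_edges_rot switch_edges_at // setUC.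
    by rewrite symdiff_set2 ?card_swap ?inE // adj_sym.
exists G'; split=> //.
by rewrite adj_realization_graph dG dG' EG' symdiffKl card_switch_edges.
Qed.

(** The failure of every switch at [v] that trades [s] for [t] nests the
    neighbourhoods of [t] and [s], up to [s] and [t] themselves, and [v] makes
    the inclusion strict. *)
Lemma switch_or_lt {G} {v s t} : realizes d G ->
  adj G v s -> ~~ adj G v t -> v != t ->
  (exists G', [/\ realizes d G', adj (realization_graph d) G G' &
    nbhd G' v = t |: nbhd G v :\ s]) \/ d t < d s.
Proof.
move=> dG vs vt v_t.
have [/existsP[x /and3P[xt sx s_x]] | /existsPn no_x] :=
  boolP [exists x, [&& adj G x t, ~~ adj G s x & s != x]].
  by left; apply: (switch_realization dG vs xt) => //; rewrite adj_sym.
right; rewrite -!(realizes_deg _ _ dG).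
(* An edge [st] would add one to both degrees, so it can be left out. *)
rewrite (cardsD1 s (nbhd G t)) (cardsD1 t (nbhd G s)) !inE (adj_sym _ t s).
rewrite ltn_add2l; apply: proper_card; apply/properP; split.
  apply/subsetP => x; rewrite !inE => /andP[x_s tx].
  move: (no_x x); rewrite adj_sym tx eq_sym x_s andbT negbK /= => ->.
  by rewrite eq_sym (adj_neq tx).
exists v; rewrite !inE; first by rewrite v_t adj_sym vs.
by rewrite negb_and adj_sym vt orbT.
Qed.

(** * Adjacent realizations *)

Lemma nbhd_setD_sym {G H} u : realizes d G -> realizes d H ->
  #|nbhd G u :\: nbhd H u| = #|nbhd H u :\: nbhd G u|.
Proof. by move=> dG dH; apply: card_setD_sym; rewrite !realizes_deg. Qed.

(** The private neighbours of [v] are balanced between [G] and [H], so it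
    suffices to exclude two on each side. These would make the four exchanged
    edges a star centred at [v], whose leaves are not balanced. *)
Lemma symdiff_nbhd_of_adj {G H} {v} : adj (realization_graph d) G H ->
  nbhd G v != nbhd H v -> #|symdiff (nbhd G v) (nbhd H v)| = 2.
Proof.
rewrite adj_realization_graph => /and3P[dG dH /eqP D4] neq.
have bal := nbhd_setD_sym v dG dH.
rewrite card_symdiff -bal addnn.
suff -> : #|nbhd G v :\: nbhd H v| = 1 by [].
apply/eqP; rewrite eqn_leq andbC; apply/andP; split.
  rewrite lt0n; apply: contraNneq neq => k0.
  by rewrite eqEsubset -!setD_eq0 -!cards_eq0 -bal k0.
rewrite leqNgt; apply/negP => k_gt1.
pose star := [set [set v; y] | y in symdiff (nbhd G v) (nbhd H v)].
have star_sub : star \subset symdiff (edges G) (edges H).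
  by apply/subsetP => e /imsetP[y]; rewrite !inE => yD ->.
have star_card : #|star| = #|symdiff (nbhd G v) (nbhd H v)|.
  apply: card_imset => y z /eqP; rewrite eq_set2 eqxx.
  by case/orP => /andP[/eqP E1 /eqP E2]; subst.
have starE : star = symdiff (edges G) (edges H).
  apply/eqP; rewrite eqEcard star_sub D4 star_card card_symdiff -bal addnn.
  by rewrite (leq_double 2).
have /card_gt0P[s] := ltnW k_gt1; rewrite !inE => /andP[Hvs Gvs].
(* Balance at [s] demands a second exchanged edge [sy], outside the star. *)
have : 0 < #|nbhd H s :\: nbhd G s|.
  rewrite -(nbhd_setD_sym s dG dH); apply/card_gt0P; exists v.
  by rewrite !inE !(adj_sym _ s v) Hvs.
case/card_gt0P => y; rewrite !inE => /andP[Gsy Hsy].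
have : [set s; y] \in star.
  by rewrite starE !inE -/(adj G s y) Gsy -/(adj H s y) Hsy orbT.
case/imsetP => z _ /eqP; rewrite eq_set2 eq_sym (negbTE (adj_neq Gvs)) /=.
by case/andP => _ /eqP yv; move: Gsy; rewrite yv adj_sym Gvs.
Qed.

(** * The quotient *)

Lemma fiber_indexP {v S} : S \in fiber_index d v ->
  exists2 G, realizes d G & nbhd G v = S.
Proof.
rewrite inE => /andP[_ /set0Pn[G]]; rewrite !inE => /andP[dG /eqP NG].
by exists G.
Qed.

Lemma quotient_at_of_switch {G G'} {v} {S T} :
  S \in fiber_index d v -> T \in fiber_index d v -> S != T ->
  realizes d G -> nbhd G v = S -> realizes d G' -> nbhd G' v = T ->
  adj (realization_graph d) G G' -> adj (quotient_at d v) S T.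
Proof.
move=> IS IT neq dG NG dG' NG' GG'; rewrite adj_quotient_at IS IT neq /=.
apply/exists_inP; exists G; first by rewrite !inE dG NG eqxx.
by apply/exists_inP; exists G'; rewrite // !inE dG' NG' eqxx.
Qed.

(** In the converse direction the switch is sought first in a realization [G]
    with neighbourhood [S] of [v], then in one, [H], with neighbourhood [T]:
    failing in both would give [d t < d s < d t]. *)
Lemma adj_quotient_atP v S T :
  S \in fiber_index d v -> T \in fiber_index d v ->
  adj (quotient_at d v) S T <-> #|symdiff S T| = 2.
Proof.
move=> IS IT; split.
  rewrite adj_quotient_at => /and4P[_ _ neq /exists_inP[G]].
  rewrite !inE => /andP[_ /eqP NG] /exists_inP[H].
  rewrite !inE => /andP[_ /eqP NH] /symdiff_nbhd_of_adj; rewrite -NG -NH.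
  by apply; rewrite NG NH.
move=> ST2.
have neq : S != T.
  by apply/eqP => ST; move: ST2; rewrite ST card_symdiff setDv cards0.
have cST : #|S :\: T| = #|T :\: S|.
  by apply: card_setD_sym; rewrite !(@card_fiber_index _ d v).
move: (ST2); rewrite card_symdiff -cST addnn => /(@double_inj _ 1) /eqP S1.
move: (S1); rewrite cST => /cards1P[t TS]; case/cards1P: S1 => s {}ST.
have [sS sT] : s \in S /\ s \notin T.
  by move: (set11 s); rewrite -ST => /setDP.
have [tT tS] : t \in T /\ t \notin S.
  by move: (set11 t); rewrite -TS => /setDP.
have swap (A B : {set V}) a b : A :\: B = [set a] -> B :\: A = [set b] ->
    b |: A :\ a = B.
  move=> <- <-; apply/setP => y; rewrite !inE.
  by case: (y \in A); case: (y \in B).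
have [G dG NG] := fiber_indexP IS; have [H dH NH] := fiber_indexP IT.
have Gvs : adj G v s by move: sS; rewrite -NG inE.
have Gvt : ~~ adj G v t by move: tS; rewrite -NG inE.
have Hvt : adj H v t by move: tT; rewrite -NH inE.
have Hvs : ~~ adj H v s by move: sT; rewrite -NH inE.
have [[G' [dG' GG' NG']] | ts] := switch_or_lt dG Gvs Gvt (adj_neq Hvt).
  apply: (quotient_at_of_switch IS IT neq dG NG dG' _ GG').
  by rewrite NG' NG (swap S T).
have [[H' [dH' HH' NH']] | st] := switch_or_lt dH Hvt Hvs (adj_neq Gvs).
  rewrite adj_sym.
  apply: (quotient_at_of_switch IT IS _ dH NH dH' _ HH').
    by rewrite eq_sym.
  by rewrite NH' NH (swap T S).
by move: (ltn_trans ts st); rewrite ltnn.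
Qed.

End Realizations.

Theorem corollary5p5 (V : finType) (d : V -> 'I_#|V|) (v : V)
    (hd : graphical d) :
  quotient_at d v = johnson (fiber_index d v) /\
  (forall S T : {set V}, S \in fiber_index d v -> T \in fiber_index d v ->
     (adj (quotient_at d v) S T <-> #|symdiff S T| = 2)).
Proof.
have adjP := adj_quotient_atP v; split; last exact: adjP.
apply: sgraph_ext => // S T; rewrite adj_johnson.
have [IS|nIS] := boolP (S \in fiber_index d v); last first.
  by rewrite adj_quotient_at (negbTE nIS).
have [IT|nIT] := boolP (T \in fiber_index d v); last first.
  by rewrite adj_quotient_at (negbTE nIT) andbF.
by apply/idP/eqP => /adjP; apply.
Qed.
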